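(* Let $G$ be a finite group of order $|G| = n$ and let $a \in G$. Then the number $N_a$ is given as follows. (1) If $G$ is a cyclic group of prime-power order, then $N_a = n$ for each $a \in G$. (2) If $G$ is a cyclic group of non-prime-power order, then $N_a = \phi(n)+1$ if $a$ is the identity or a generator of $G$, and $N_a = \phi(d)$ otherwise, where $d$ is the order of $a$. (3) If $G$ is a non-cyclic group, then: (a) for the identity $e \in G$, $N_e = 2$ if $G$ is a generalized quaternion group of order $2^m$ for some $m$, and $N_e = 1$ otherwise; (b) if $a \neq e$ is an element of non-prime-power order $d$, then $N_a = \phi(d)$; (c) if $a \neq e$ has prime-power order $d$ and there exists an element $b \in G$ of non-prime-power order such that $\langle a\rangle \subsetneq \langle b\rangle$, then $N_a = \phi(d)$.
   Context: For a group $G$, the power graph $\mathscr{P}(G)$ is the simple graph with vertex set $G$ in which two distinct vertices $a,b$ are adjacent if and only if $\langle a\rangle \subseteq \langle b\rangle$ or $\langle b\rangle \subseteq \langle a\rangle$. For $a \in G$, $N(a)$ denotes the set of neighbors of $a$ in $\mathscr{P}(G)$ (so $a\notin N(a)$), $\widetilde{N(a)} = \{b \in N(a) \mid N(a)\setminus\{b\} = N(b)\setminus\{a\}\}$ is the set of closed twins of $a$, and $N_a = |\widetilde{N(a)}| + 1$. Here $\phi$ is Euler's totient function. An order is a non-prime-power if it is divisible by at least two distinct primes. *)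

(* Defs.v *)
From mathcomp Require Import all_boot all_fingroup all_solvable.

Set Implicit Arguments.
Unset Strict Implicit.
Unset Printing Implicit Defensive.

Local Open Scope group_scope.

Definition power_adj (gT : finGroupType) : rel gT :=
  [rel a b : gT | (a != b) && ((<[a]> \subset <[b]>) || (<[b]> \subset <[a]>))].

(* The vertex set of the power graph is G, a group inside the ambient gT. *)
Definition power_nbhd (gT : finGroupType) (G : {set gT}) (a : gT) : {set gT} :=
  [set b in G | power_adj a b].

Definition closed_twins (gT : finGroupType) (G : {set gT}) (a : gT) : {set gT} :=
  [set b in power_nbhd G a | power_nbhd G a :\ b == power_nbhd G b :\ a].

Definition twin_number (gT : finGroupType) (G : {set gT}) (a : gT) : nat :=
  #|closed_twins G a|.+1.

(* The exponent 0 is allowed, so 1 is a prime power: prime_power is the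
   complement of non_prime_power on the positive integers. *)
Definition prime_power (n : nat) : Prop :=
  exists p k : nat, prime p /\ n = (p ^ k)%N.

Definition non_prime_power (n : nat) : Prop :=
  exists p q : nat, [/\ prime p, prime q, p != q, p %| n & q %| n].

(* 'Q_(2 ^ m) is a generalized quaternion group only for m >= 3. *)
Definition generalized_quaternion (gT : finGroupType) (G : {set gT}) : Prop :=
  exists2 m : nat, 2 < m & G \isog 'Q_(2 ^ m).

(* Main.v *)
Require Import Defs.
From mathcomp Require Import all_boot all_fingroup all_solvable.

Local Open Scope group_scope.

(** Two elements of G lie in the same twin class exactly when the same elements of
    G are comparable with them, where x and y are comparable if one of <x>, <y>
    contains the other; so N_a is the size of the class of a.  In a cyclic group
    comparability is divisibility of orders, and if n is not a prime power, a
    divisor of n is determined by the divisors of n comparable with it, except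
    that 1 and n are both comparable with all of them.  Restricting twins of G to
    a cyclic subgroup of non-prime-power order settles every case but that of an
    element x <> 1 comparable with all of a non-cyclic G.  Such an x has
    prime-power order (otherwise G = <x>), so G is a p-group and <x> contains all
    its elements of order p; hence G has a unique subgroup of order p, i.e. it is
    generalized quaternion. *)

(** * Prime powers and comparability of divisors *)

Lemma prime_power_dichotomy {n : nat} :
  0 < n -> prime_power n \/ non_prime_power n.
Proof.
move=> n_gt0; case: (ltngtP n 1) => [|n_gt1|->]; first by rewrite ltnNge n_gt0.
  have p_pr := pdiv_prime n_gt1.
  case: (boolP ((pdiv n).-nat n)) => [/p_natP[k ->]|].
    by left; exists (pdiv n), k.
  rewrite /pnat n_gt0 /= => /allPn[q]; rewrite mem_primes => /and3P[q_pr _ q_n].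
  rewrite !inE => qNp; right; exists q, (pdiv n); split=> //.
  exact: pdiv_dvd.
by left; exists 2, 0.
Qed.

Lemma non_prime_powerW {d n : nat} :
  non_prime_power d -> d %| n -> non_prime_power n.
Proof.
case=> p [q [p_pr q_pr pNq p_d q_d]] d_n.
by exists p, q; split=> //; apply: dvdn_trans d_n.
Qed.

Lemma non_prime_power_neq {n : nat} (p : nat) :
  non_prime_power n -> exists q, [/\ prime q, q %| n & q != p].
Proof.
case=> p1 [p2 [p1_pr p2_pr p1Np2 p1_n p2_n]].
by case: (eqVneq p1 p) => [<-|]; [exists p2; rewrite eq_sym | exists p1].
Qed.

Lemma not_non_prime_power_expn {p : nat} (k : nat) :
  prime p -> ~ non_prime_power (p ^ k).
Proof.
move=> p_pr /(non_prime_power_neq p)[q [q_pr q_pk]].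
by move: q_pk; rewrite Euclid_dvdX // dvdn_prime2 // => /andP[->].
Qed.

Definition dvdn_comparable (d k : nat) : bool := (d %| k) || (k %| d).

(** If [d != 1] divided the [p]-part of [n], a prime divisor [q != p] of [n], being comparable with
    [d], would divide [d] and hence a power of [p]. So every primary part of [n] divides [d]. *)
Lemma dvdn_comparable_all {n d : nat} :
    0 < n -> non_prime_power n -> d %| n ->
    (forall k, k %| n -> dvdn_comparable d k) ->
  d = 1%N \/ d = n.
Proof.
move=> n_gt0 nppn d_n dcmp; case: (eqVneq d 1%N) => [|dN1]; [by left | right].
apply/eqP; rewrite eqn_dvd d_n; apply/dvdn_partP=> // p.
rewrite mem_primes => /and3P[p_pr _ _].
case/orP: (dcmp _ (dvdn_part p n)) => //; rewrite p_part => d_pn.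
have [q [q_pr q_n qNp]] := non_prime_power_neq p nppn.
have q_d: q %| d.
  case/orP: (dcmp q q_n) => // d_q; case/primeP: q_pr => _ /(_ d d_q).
  by rewrite (negPf dN1) => /eqP->.
have := dvdn_trans q_d d_pn.
rewrite Euclid_dvdX // dvdn_prime2 // (negPf qNp) //.
Qed.

Lemma dvdn_comparable_separates {n d e : nat} :
    0 < n -> non_prime_power n -> d %| e -> e %| n ->
    (forall k, k %| n -> dvdn_comparable d k = dvdn_comparable e k) ->
  d = e \/ (d = 1%N /\ e = n).
Proof.
move=> n_gt0 nppn d_e e_n decmp; have e_gt0 := dvdn_gt0 n_gt0 e_n.
have d_n := dvdn_trans d_e e_n.
case: (eqVneq d 1%N) => [d1|dN1].
  have [k k_n|->|->] := dvdn_comparable_all n_gt0 nppn e_n; rewrite ?d1; auto.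
  by rewrite -decmp // d1 /dvdn_comparable dvd1n.
have [[p [k [p_pr def_e]]]|nppe] := prime_power_dichotomy e_gt0; last first.
  (* Divisors of [e] are comparable with [e], hence with [d]: the previous lemma applies with [e] in
     place of [n]. *)
  have [k k_e|d1|] := dvdn_comparable_all e_gt0 nppe d_e; last by left.
    by rewrite decmp ?(dvdn_trans k_e) // /dvdn_comparable k_e orbT.
  by rewrite d1 in dN1.
have [q [q_pr q_n qNp]] := non_prime_power_neq p nppn.
have co_eq: coprime e q.
  by rewrite def_e coprimeXl // prime_coprime // dvdn_prime2 // eq_sym.
have co_dq: coprime d q by apply: coprime_dvdl co_eq.
(* The separating divisor is [d * q]: it is comparable with [d], hence with [e], and since [e] is
   prime to [q] this forces [e %| d]. *)
have dq_n: d * q %| n by rewrite Gauss_dvd // d_n.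
have := decmp _ dq_n; rewrite /dvdn_comparable dvdn_mulr // Gauss_dvdl //.
case/esym/orP=> [e_d|dq_e]; first by left; apply/eqP; rewrite eqn_dvd d_e.
have: q %| gcdn e q by rewrite dvdn_gcd dvdnn (dvdn_trans _ dq_e) ?dvdn_mull.
by rewrite (eqP co_eq) dvdn1 => /eqP q1; rewrite q1 in q_pr.
Qed.

(** * Comparability and twins in a finite group *)

Section PowerGraph.

Variable gT : finGroupType.
Implicit Types (G H : {group gT}) (a b c x y : gT).

(** Adjacency made reflexive, so that closed twins can be compared without deleting vertices. *)
Definition cycle_comparable (a b : gT) : bool :=
  (<[a]> \subset <[b]>) || (<[b]> \subset <[a]>).

Definition power_twins (G : {set gT}) (a b : gT) : bool :=
  [forall c in G, cycle_comparable a c == cycle_comparable b c].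

Lemma cycle_comparable_sym a b : cycle_comparable a b = cycle_comparable b a.
Proof. exact: orbC. Qed.

Lemma cycle_comparable_refl a : cycle_comparable a a.
Proof. by rewrite /cycle_comparable subxx. Qed.

Lemma cycle_comparable1 a : cycle_comparable 1 a.
Proof. by rewrite /cycle_comparable cycle1 sub1G. Qed.

Lemma power_twinsP {G : {set gT}} {a b} :
  reflect {in G, cycle_comparable a =1 cycle_comparable b} (power_twins G a b).
Proof. exact: eqfun_inP. Qed.

Lemma power_twins_sym (G : {set gT}) a b : power_twins G a b = power_twins G b a.
Proof. by apply: eq_forallb_in => c _; rewrite eq_sym. Qed.

Lemma power_twinsS {G H : {set gT}} {a b} :
  H \subset G -> power_twins G a b -> power_twins H a b.
Proof.
by move=> /subsetP sHG /power_twinsP ab; apply/power_twinsP=> c /sHG/ab.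
Qed.

Lemma power_twins_comparable {G a b} :
  b \in G -> power_twins G a b -> cycle_comparable a b.
Proof. by move=> Gb /power_twinsP->; rewrite ?cycle_comparable_refl. Qed.

Lemma eq_cycle_twins (G : {set gT}) a b : <[a]> = <[b]> -> power_twins G a b.
Proof. by move=> ab; apply/power_twinsP=> c _; rewrite /cycle_comparable ab. Qed.

Lemma power_twins1P {G a} :
  reflect {in G, forall b, cycle_comparable a b} (power_twins G 1 a).
Proof.
apply: (iffP power_twinsP) => a_dom b Gb; first by rewrite -a_dom ?cycle_comparable1.
by rewrite a_dom ?cycle_comparable1.
Qed.

Lemma in_power_nbhd (G : {set gT}) a b :
  (b \in power_nbhd G a) = [&& b \in G, a != b & cycle_comparable a b].
Proof. by rewrite inE. Qed.

(** The successor counts [a] itself. For [b != a], deleting [a] and [b] from the neighbourhoods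
    loses nothing, as adjacent [a] and [b] are both comparable with each of the two. *)
Lemma twin_numberE G a :
  a \in G -> twin_number G a = #|[set b in G | power_twins G a b]|.
Proof.
move=> Ga; rewrite [RHS](cardsD1 a) inE Ga eq_cycle_twins // add1n.
congr (_.+1); apply: eq_card => b; rewrite in_setD1 [LHS]in_set in_power_nbhd in_set (eq_sym b).
case: (eqVneq a b) => [|aNb]; first by rewrite andbF.
case Gb: (b \in G) => //=.
apply/andP/power_twinsP => [[ab_cmp /eqP/setP ab] c Gc|ab].
  have := ab c; rewrite !in_setD1 !in_power_nbhd Gc /= !(eq_sym _ c).
  case: (eqVneq c a) => [->|_] /=.
    by rewrite (cycle_comparable_sym b) cycle_comparable_refl ab_cmp.
  case: (eqVneq c b) => [->|_] //=.
  by rewrite cycle_comparable_refl ab_cmp.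
split; first by rewrite (ab b) ?cycle_comparable_refl.
apply/eqP/setP=> c; rewrite !in_setD1 !in_power_nbhd !(eq_sym _ c).
case Gc: (c \in G); last by rewrite !andbF.
by rewrite (ab c Gc) /= andbCA.
Qed.

(** The generators of [<[a]>] are always twins of [a], so only the converse is left to each case. *)
Lemma twin_number_totient {G a} :
    a \in G -> (forall c, c \in G -> power_twins G a c -> <[a]> = <[c]>) ->
  twin_number G a = totient #[a].
Proof.
move=> Ga sub_gen; rewrite twin_numberE // totient_gen.
apply: eq_card => c; rewrite !inE; apply/andP/eqP => [[]|ac]; first exact: sub_gen.
by rewrite eq_cycle_twins // -cycle_subG -ac cycle_subG.
Qed.

(** * Twins in cyclic groups *)

Lemma cycle_comparable_order {H a b} :
    cyclic H -> a \in H -> b \in H ->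
  cycle_comparable a b = dvdn_comparable #[a] #[b].
Proof.
by move=> cycH Ha Hb; rewrite /cycle_comparable /dvdn_comparable !(cardSg_cyclic cycH) ?cycle_subG.
Qed.

Lemma eq_order_cyclic {H a b} :
  cyclic H -> a \in H -> b \in H -> #[a] = #[b] -> <[a]> = <[b]>.
Proof.
move=> cycH Ha Hb ab; apply/eqP.
by rewrite (eq_subG_cyclic cycH) ?cycle_subG // -!orderE ab.
Qed.

Lemma power_twins_order {H a b} :
    cyclic H -> a \in H -> b \in H -> power_twins H a b ->
  forall k, k %| #|H| -> dvdn_comparable #[a] k = dvdn_comparable #[b] k.
Proof.
move=> cycH Ha Hb /power_twinsP ab k k_H; have /cyclicP[h defH] := cycH.
(* An element of order [k], so that comparing with elements tests every divisor. *)
have Hhk: h ^+ (#|H| %/ k) \in H by rewrite defH mem_cycle.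
have oh: #[h] = #|H| by rewrite defH.
have := ab _ Hhk; rewrite !(cycle_comparable_order cycH) // orderXdiv.
  by rewrite oh divnA // mulKn.
by rewrite oh dvdn_div.
Qed.

Lemma power_twins_cyclic_sub {H a b} :
    cyclic H -> non_prime_power #|H| -> a \in H -> b \in H ->
    <[a]> \subset <[b]> -> power_twins H a b ->
  <[a]> = <[b]> \/ (a = 1 /\ H :=: <[b]>).
Proof.
move=> cycH nppH Ha Hb sab ab.
have := dvdn_comparable_separates (cardG_gt0 H) nppH (cardSg sab)
  (order_dvdG Hb) (power_twins_order cycH Ha Hb ab).
case=> [oab|[/eqP oa ob]]; first by left; apply: (eq_order_cyclic cycH).
right; split; first by apply/eqP; rewrite -order_eq1.
by apply/esym/eqP; rewrite eqEcard cycle_subG Hb -orderE -ob orderE /=.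
Qed.

Lemma power_twins_cyclic {H a b} :
    cyclic H -> non_prime_power #|H| -> a \in H -> b \in H ->
    a != 1 -> H :!=: <[a]> -> power_twins H a b ->
  <[a]> = <[b]>.
Proof.
move=> cycH nppH Ha Hb aN1 aNgen ab.
case/orP: (power_twins_comparable Hb ab) => [sab|sba].
  case: (power_twins_cyclic_sub cycH nppH Ha Hb sab ab) => // [[a1 _]].
  by rewrite a1 eqxx in aN1.
rewrite power_twins_sym in ab.
case: (power_twins_cyclic_sub cycH nppH Hb Ha sba ab) => // [[_ /eqP]].
by rewrite (negPf aNgen).
Qed.

Lemma power_twins_cycle {a b} :
    non_prime_power #[b] -> a != 1 -> <[a]> \subset <[b]> ->
    power_twins <[b]> a b ->
  <[a]> = <[b]>.
Proof.
move=> nppb aN1 sab ab; have ba: a \in <[b]> by rewrite -cycle_subG.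
have [//|[a1 _]] :=
  power_twins_cyclic_sub (cycle_cyclic b) nppb ba (cycle_id b) sab ab.
by rewrite a1 eqxx in aN1.
Qed.

(** * Elements comparable with a whole non-cyclic group *)

(** If [x] has order [p ^ k], Cauchy gives an element of order [q] for each prime [q] dividing
    [#|G|]; its comparability with [x] forces [q = p]. *)
Lemma dominating_pgroup {G x} :
    ~~ cyclic G -> x \in G -> x != 1 -> power_twins G 1 x ->
  exists p, [/\ prime p, p.-group G & p %| #[x]].
Proof.
move=> ncycG Gx xN1 /power_twins1P x_dom.
have [[p [k [p_pr ox]]]|nppx] := prime_power_dichotomy (order_gt0 x).
  have k_gt0: 0 < k.
    by case: k ox => // /eqP; rewrite order_eq1 (negPf xN1).
  exists p; split=> //; last by rewrite ox dvdn_exp.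
  apply/pgroupP=> q q_pr /Cauchy[//|y Gy oy]; rewrite inE.
  have: dvdn_comparable #[x] #[y].
    by apply/orP; case/orP: (x_dom y Gy) => /cardSg; [left | right].
  rewrite /dvdn_comparable oy ox -(prednK k_gt0).
  case/orP=> [/(dvdn_trans (dvdn_exp _ (dvdnn p)))|].
    by rewrite dvdn_prime2 // eq_sym; apply.
  by rewrite Euclid_dvdX // dvdn_prime2 // => /andP[].
case/negP: ncycG; suff ->: G :=: <[x]> by apply: cycle_cyclic.
apply/eqP; rewrite eqEsubset [X in _ && X]cycle_subG Gx andbT.
apply/subsetP=> y Gy; rewrite -cycle_subG.
case/orP: (x_dom y Gy) => // sxy; suff <-: <[x]> = <[y]> by [].
(* Both [x] and [y] are comparable with all of [<[y]>], so they are twins there. *)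
apply: (power_twins_cycle (non_prime_powerW nppx (cardSg sxy)) xN1 sxy).
apply/power_twinsP=> z yz; rewrite x_dom.
  by rewrite /cycle_comparable [<[z]> \subset _]cycle_subG yz orbT.
by apply: subsetP yz; rewrite cycle_subG.
Qed.

Lemma dominating_quaternion {G x} :
    ~~ cyclic G -> x \in G -> x != 1 -> power_twins G 1 x ->
  generalized_quaternion G.
Proof.
move=> ncycG Gx xN1 xdom.
have [p [p_pr pG p_x]] := dominating_pgroup ncycG Gx xN1 xdom.
have GN1: G :!=: 1 by apply: contraNneq ncycG => ->; apply: cyclic1.
have [y xy oy] := Cauchy p_pr p_x.
have Ohm1G: 'Ohm_1(G) = <[y]>.
  have Gy: y \in G by apply: subsetP xy; rewrite cycle_subG.
  apply/eqP; rewrite eqEsubset Ohm1Eprime gen_subG [X in _ && X]cycle_subG.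
  rewrite mem_gen ?inE ?Gy ?oy // andbT; apply/subsetP=> z.
  rewrite inE => /andP[Gz z_pr]; rewrite -cycle_subG.
  have oz: #[z] = p.
    by have := mem_p_elt pG Gz; rewrite /p_elt pnatE // inE => /eqP.
  suff xz: z \in <[x]>.
    by rewrite (eq_order_cyclic (cycle_cyclic x) xz xy) ?oz ?oy.
  rewrite -cycle_subG; case/orP: (power_twins1P xdom z Gz) => // sxz.
  suff <-: <[x]> = <[z]> by [].
  by apply/eqP; rewrite eqEcard sxz -!orderE oz dvdn_leq ?order_gt0.
(* A nontrivial [p]-group whose ['Ohm_1] has order [p] is cyclic, or quaternion with [p = 2]. *)
have := introT (prime_Ohm1P pG GN1); rewrite Ohm1G -orderE oy.
by rewrite (negPf ncycG) => /(_ erefl) /andP[_ /eqP/quaternion_classP].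
Qed.

(** The class of 1 is 1 and the unique involution [z], which lies in every nontrivial cyclic
    subgroup. A dominating [b] of order at least 4 would contain all elements outside [<[x]>], as
    these have order 4. *)
Lemma twin_number1_quaternion G :
  generalized_quaternion G -> twin_number G 1 = 2.
Proof.
case=> m m_gt2 isoG.
have [[x y] genG _] := generators_quaternion m_gt2 isoG.
have [[_ oX' _] _ [defZ oZ uniq_z _ _] _ _] := quaternion_structure m_gt2 genG isoG.
have [oG Gx ox /setDP[Gy X'y]] := genG; set z := x ^+ _ in defZ uniq_z.
have Gz: z \in G by rewrite groupX.
have oz: #[z] = 2 by rewrite orderE -defZ.
have zN1: z != 1 by rewrite -order_gt1 oz.
have pG: 2.-group G by rewrite /pgroup oG pnatX.
rewrite twin_numberE ?group1 // -[RHS](_ : #|[set 1; z]| = 2); last first.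
  by rewrite cards2 eq_sym zN1.
apply: eq_card => b; rewrite in_set !inE.
case: (eqVneq b 1) => [->|bN1] /=; first by rewrite group1 eq_cycle_twins.
apply/andP/eqP=> [[Gb /power_twins1P b_dom]|->]; last first.
  split=> //; apply/power_twins1P=> c Gc.
  have [->|cN1] := eqVneq c 1.
    by rewrite cycle_comparable_sym cycle_comparable1.
  have [k oc] := p_natP (mem_p_elt pG Gc).
  have c_even: 2 %| #|<[c]>|.
    rewrite -orderE oc; case: k oc => [/eqP|k _]; first by rewrite order_eq1 (negPf cN1).
    by rewrite expnS dvdn_mulr.
  have [u cu ou] := @Cauchy _ 2 <[c]> isT c_even.
  have Gu: u \in G by apply: subsetP cu; rewrite cycle_subG.
  by rewrite /cycle_comparable cycle_subG -(uniq_z u) ?cu.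
apply: uniq_z => //; have [k ob] := p_natP (mem_p_elt pG Gb).
case: k ob => [/eqP|[//|k] ob]; first by rewrite order_eq1 (negPf bN1).
have X'_sub t: t \in G -> t \notin <[x]> -> t \in <[b]>.
  move=> Gt X't; have ot: #[t] = 4 by apply: oX'; rewrite inE X't.
  rewrite -cycle_subG; case/orP: (b_dom t Gt) => // sbt.
  suff <-: <[b]> = <[t]> by [].
  by apply/eqP; rewrite eqEcard sbt -!orderE ot ob dvdn_leq ?expn_gt0 //
     (dvdn_exp2l 2 (_ : 2 <= _)).
have yb := X'_sub y Gy X'y.
have bx: x \in <[b]>.
  (* Since [x * y] is also outside [<[x]>], it lies in [<[b]>] with [y]. *)
  rewrite -(groupMr _ yb); apply: X'_sub; first exact: groupM.
  by rewrite groupMl ?cycle_id.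
have oy: #[y] = 4 by apply: oX'; rewrite inE X'y.
(* Inside the cyclic [<[b]>], inclusion is divisibility of orders, and 4 divides [2 ^ m.-1] because
   [m > 2]. *)
case/negP: X'y; rewrite -cycle_subG -(cardSg_cyclic (cycle_cyclic b)) ?cycle_subG //.
rewrite -!orderE ox oy.
by rewrite (dvdn_exp2l 2 (_ : 2 <= _)) // -ltnS prednK // ltnW // ltnW.
Qed.

Lemma twin_number1_not_quaternion G :
  ~~ cyclic G -> ~ generalized_quaternion G -> twin_number G 1 = 1%N.
Proof.
move=> ncycG nquatG; rewrite twin_numberE // -(cards1 (1 : gT)).
apply: eq_card => b; rewrite !inE; apply/andP/eqP => [[Gb b_dom]|->].
  case: (eqVneq b 1) => // bN1; case: nquatG.
  exact: dominating_quaternion b_dom.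
by rewrite eq_cycle_twins.
Qed.

(** * Twin numbers in cyclic groups *)

Lemma cycle_comparable_cyclic_pgroup {G a b} :
  cyclic G -> prime_power #|G| -> a \in G -> b \in G -> cycle_comparable a b.
Proof.
move=> cycG [p [k [p_pr oG]]] Ga Gb.
rewrite (cycle_comparable_order cycG) // /dvdn_comparable.
have := order_dvdG Ga; have := order_dvdG Gb; rewrite oG.
case/(dvdn_pfactor _ _ p_pr)=> i _ -> /(dvdn_pfactor _ _ p_pr)[j _ ->].
by case: (leqP i j) => [|/ltnW] le_ij; rewrite (dvdn_exp2l p le_ij) ?orbT.
Qed.

Lemma twin_number_cyclic_prime_power {G a} :
  cyclic G -> prime_power #|G| -> a \in G -> twin_number G a = #|G|.
Proof.
move=> cycG ppG Ga; rewrite twin_numberE //; apply: eq_card => b; rewrite inE.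
case Gb: (b \in G) => //=; apply/power_twinsP => c Gc.
by rewrite !(cycle_comparable_cyclic_pgroup cycG ppG).
Qed.

Lemma twin_number_cyclic_dominating {G a} :
    cyclic G -> non_prime_power #|G| -> a = 1 \/ generator G a ->
  twin_number G a = (totient #|G|).+1.
Proof.
move=> cycG nppG a_1gen.
have gen_in b : generator G b -> b \in G by move=> /eqP->; apply: cycle_id.
have Ga: a \in G by case: a_1gen => [->|/gen_in].
have gen_dom b : generator G b -> power_twins G 1 b.
  move=> /eqP defG; apply/power_twins1P=> c Gc.
  by rewrite /cycle_comparable -defG !cycle_subG Gc orbT.
have a_dom: power_twins G 1 a.
  by case: a_1gen => [->|/gen_dom//]; apply: eq_cycle_twins.
have [g defG] := cyclicP cycG.
have GN1: G :!=: 1.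
  apply/eqP=> G1; move: nppG; rewrite G1 cards1.
  exact: (not_non_prime_power_expn 0 (isT : prime 2)).
rewrite twin_numberE // [in totient _]defG -orderE totient_gen -defG.
have n1_gen: 1 \notin [set x | generator G x].
  by rewrite inE /generator cycle1.
(* The summand 1 is rewritten as the truth value of [1 \notin _], the form that [cardsU1]
   expects. *)
rewrite -[RHS]add1n -[X in (X + _)%N]/(nat_of_bool true) -n1_gen -cardsU1.
apply: eq_card => b; rewrite !inE; apply/andP/orP => [[Gb ab]|b_1gen].
  have b_dom: power_twins G 1 b.
    apply/power_twins1P=> c Gc.
    by rewrite -(power_twinsP ab) ?(power_twins1P a_dom).
  have := power_twins_cyclic_sub cycG nppG (group1 G) Gb.
  rewrite cycle1 sub1G => /(_ isT b_dom)[/esym/eqP|[_ defGb]].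
    by rewrite cycle_eq1; left.
  by right; rewrite /generator defGb.
have b_dom: power_twins G 1 b.
  by case: b_1gen => [/eqP->|/gen_dom//]; apply: eq_cycle_twins.
have Gb: b \in G by case: b_1gen => [/eqP->|/gen_in].
split=> //; apply/power_twinsP=> c Gc.
by rewrite (power_twins1P a_dom) ?(power_twins1P b_dom).
Qed.

Lemma twin_number_cyclic_proper {G a} :
    cyclic G -> non_prime_power #|G| -> a \in G -> ~ (a = 1 \/ generator G a) ->
  twin_number G a = totient #[a].
Proof.
move=> cycG nppG Ga a_N1gen; apply: twin_number_totient => // c Gc.
apply: power_twins_cyclic => //; first by apply/eqP=> a1; case: a_N1gen; left.
by apply/negP=> defG; case: a_N1gen; right.
Qed.

(** * Twin numbers in non-cyclic groups *)

(** The larger of [<[a]>] and [<[c]>] has non-prime-power order, so twins can be restricted to it.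
    Only [c = 1] escapes, and then [G] would be a [p]-group. *)
Lemma twin_number_non_prime_power {G a} :
    ~~ cyclic G -> a \in G -> non_prime_power #[a] ->
  twin_number G a = totient #[a].
Proof.
move=> ncycG Ga nppa; apply: twin_number_totient => // c Gc ac.
have aN1: a != 1.
  apply/eqP=> a1; move: nppa; rewrite a1 order1.
  exact: (not_non_prime_power_expn 0 (isT : prime 2)).
have sGa: <[a]> \subset G by rewrite cycle_subG.
have sGc: <[c]> \subset G by rewrite cycle_subG.
case/orP: (power_twins_comparable Gc ac) => [sac|sca].
  have nppc := non_prime_powerW nppa (cardSg sac).
  exact: power_twins_cycle nppc aN1 sac (power_twinsS sGc ac).
rewrite power_twins_sym in ac.
have [c1|cN1] := eqVneq c 1.
  rewrite c1 in ac; have [p [p_pr pG _]] := dominating_pgroup ncycG Ga aN1 ac.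
  have [k oa] := p_natP (mem_p_elt pG Ga).
  by case: (not_non_prime_power_expn k p_pr); rewrite -oa.
exact: esym (power_twins_cycle nppa cN1 sca (power_twinsS sGa ac)).
Qed.

(** A twin [c] of [a] is comparable with [b], so [a] and [c] both lie in [<[b]>] or both in [<[c]>],
    cyclic of non-prime-power order either way. *)
Lemma twin_number_sub_non_prime_power {G a b} :
    a \in G -> a != 1 -> b \in G -> non_prime_power #[b] ->
    <[a]> \proper <[b]> ->
  twin_number G a = totient #[a].
Proof.
move=> Ga aN1 Gb nppb prop_ab; apply: twin_number_totient => // c Gc ac.
have sGb: <[b]> \subset G by rewrite cycle_subG.
have sGc: <[c]> \subset G by rewrite cycle_subG.
have [sab nsba] := andP prop_ab.
have: cycle_comparable c b.
  by rewrite -(power_twinsP ac) // /cycle_comparable sab.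
case/orP=> [scb|sbc].
  apply: (@power_twins_cyclic <[b]>); rewrite ?cycle_cyclic -?cycle_subG //.
    by apply: contraNneq nsba => <-.
  exact: power_twinsS ac.
apply: (power_twins_cycle (non_prime_powerW nppb (cardSg sbc)) aN1).
  exact: subset_trans sab sbc.
exact: power_twinsS ac.
Qed.

End PowerGraph.

Theorem theorem3p6 (gT : finGroupType) (G : {group gT}) (n : nat) (a : gT)
    (hn : #|G| = n) (aG : a \in G) :
  [/\ (cyclic G -> prime_power n -> twin_number G a = n),
      (cyclic G -> non_prime_power n ->
         (a = 1 \/ generator G a -> twin_number G a = (totient n).+1) /\
         (~ (a = 1 \/ generator G a) -> twin_number G a = totient #[a]))
    & (~~ cyclic G ->
         [/\ (generalized_quaternion G -> twin_number G 1 = 2) /\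
             (~ generalized_quaternion G -> twin_number G 1 = 1%N),
             (a != 1 -> non_prime_power #[a] -> twin_number G a = totient #[a])
           & (a != 1 -> prime_power #[a] ->
              (exists b : gT, [/\ b \in G, non_prime_power #[b]
                                 & <[a]> \proper <[b]>]) ->
              twin_number G a = totient #[a])])].
Proof.
subst n; split=> [cycG ppG|cycG nppG|ncycG].
- exact: twin_number_cyclic_prime_power.
- split; first exact: twin_number_cyclic_dominating.
  exact: twin_number_cyclic_proper.
- split=> [|_|aN1 _ [b [Gb nppb]]].
  + split; first exact: twin_number1_quaternion.
    exact: twin_number1_not_quaternion.
  + exact: twin_number_non_prime_power.
  + exact: twin_number_sub_non_prime_power.
Qed.
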